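(* Let $(M,d,\mu)$ be a doubling metric measure space. Let $s^\sharp,p^\sharp\in(0,\infty]$ with $s^\sharp<p^\sharp$, let $q^\sharp,r^\sharp\in(s^\sharp,p^\sharp)$ and $\alpha^\sharp\ge1$. Assume that there are $\beta_1,\beta_2\in(0,1)$ such that $$\frac1{r^\sharp}=\frac{\beta_1}{p^\sharp}+\frac{1-\beta_1}{s^\sharp},\qquad\frac1{q^\sharp}=\frac{\beta_2}{p^\sharp}+\frac{1-\beta_2}{s^\sharp},\qquad\beta_2\alpha^\sharp=\beta_1 .$$ Let $B$ be a ball in $M$. Assume that there are $\lambda>1$ and a non-negative $v\in L^{p^\sharp}(\lambda B)$ such that $$\Big(⨍_{\widetilde B}v^{p^\sharp}\Big)^{\frac1{p^\sharp}}\lesssim\Big(⨍_{2\widetilde B}v^{r^\sharp}\Big)^{\frac1{r^\sharp}}+\Big(⨍_{2\widetilde B}v^{q^\sharp}\Big)^{\frac{\alpha^\sharp}{q^\sharp}}$$ holds for all balls $\widetilde B$ satisfying $2\widetilde B\subseteq\lambda B$ (with a constant independent of $\widetilde B$). Then $$\Big(⨍_{B}v^{p^\sharp}\Big)^{\frac1{p^\sharp}}\lesssim\Big(⨍_{\lambda B}v^{s^\sharp}\Big)^{\frac1{s^\sharp}}+\Big(⨍_{\lambda B}v^{s^\sharp}\Big)^{\frac{\theta}{s^\sharp}},\qquad\text{where}\quad\theta:=\frac{\alpha^\sharp(1-\beta_2)}{1-\beta_1}\in[1,\infty).$$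
   Context: Doubling means: there is $C>0$ with $\mu(B(x,2r))\le C\mu(B(x,r))$ for all $x\in M$ and $r\in(0,\operatorname{diam}(M))$, where $B(x,r)$ is the ball of radius $r$ around $x$ for the distance $d$. For a ball $B=B(x,r)$ and $c>0$, $cB=B(x,cr)$. $⨍_Ef$ denotes the average $\frac1{\mu(E)}\int_Ef\,d\mu$; for exponent $p^\sharp=\infty$ the average is replaced by the essential supremum. The notation $\lesssim$ means inequality up to a multiplicative constant; the constant in the conclusion may depend on the constant in the hypothesis, on $\lambda$, on the exponents and on the doubling constant, but not on $v$ or $B$. *)

(* Defs.v *)
From HB Require Import structures.
From mathcomp Require Import all_boot all_order all_algebra.
From mathcomp Require Import all_classical all_reals all_analysis.
From mathcomp Require Import ess_sup_inf hoelder.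

Set Implicit Arguments.
Unset Strict Implicit.
Unset Printing Implicit Defensive.

Import Order.TTheory GRing.Theory Num.Theory.
Import numFieldNormedType.Exports.

Local Open Scope classical_set_scope.
Local Open Scope ring_scope.

(* The sigma-algebra contains the Borel sets but may be larger (e.g. a
   completion). *)
HB.mixin Record Metric_isBorelMeasurable (R : realType) (d : measure_display) M
    & Metric R M & Measurable d M := {
  open_measurable_metric : forall U : set M, open U -> d.-measurable U
}.

#[short(type="metricMeasurableType")]
HB.structure Definition MetricMeasurable (R : realType) (d : measure_display) :=
  { M of Metric R M & Measurable d M & Metric_isBorelMeasurable R d M }.

Section doubling.
Context (R : realType) (d : measure_display) (M : metricMeasurableType R d).
Local Open Scope ereal_scope.

Definition diameter : \bar R :=
  ereal_sup [set z | exists x y : M, z = (mdist x y)%:E].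

(* Balls are open: [ball x r = [set y | mdist x y < r]].  That they have
   positive finite measure is part of the usual definition of a doubling
   measure, and is what makes averages over balls meaningful. *)
Definition doubling (mu : {measure set M -> \bar R}) (C : R) : Prop :=
  (forall (x : M) (r : R), (0 < r)%R -> 0 < mu (ball x r) < +oo) /\
  (forall (x : M) (r : R), (0 < r)%R -> r%:E < diameter ->
     mu (ball x (2 * r)%R) <= C%:E * mu (ball x r)).

End doubling.

Section averages.
Context (R : realType) (d : measure_display) (T : measurableType d).
Variable mu : {measure set T -> \bar R}.
Local Open Scope ereal_scope.

Definition avg (E : set T) (f : T -> R) : \bar R :=
  (mu E)^-1 * \int[mu]_(x in E) (f x)%:E.

(* Only meant for [0 < p] and [f] nonnegative on [E]; extending such an [f] by
   0 outside [E] does not change its essential supremum over [E] when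
   [0 < mu E]. *)
Definition Lavg (p : \bar R) (E : set T) (f : T -> R) : \bar R :=
  match p with
  | p%:E => avg E (fun x => f x `^ p)%R `^ p^-1
  | +oo => ess_sup mu (EFin \o (f \_ E))
  | -oo => 0
  end.

Definition nonneg_Lp_on (p : \bar R) (E : set T) (f : T -> R) : Prop :=
  [/\ measurable_fun E f, (forall x, E x -> (0 <= f x)%R)
    & finite_norm mu p (f \_ E)].

End averages.

(* Main.v *)
Require Import Defs.
From mathcomp Require Import all_boot all_order all_algebra.
From mathcomp Require Import all_classical all_reals all_analysis.
From mathcomp Require Import measurable_realfun ess_sup_inf hoelder.
From mathcomp Require Import ring lra.

(** Self-improvement of a nonlinear reverse Hoelder inequality.

    Write [m] for the mass of [lambda B], [Phi a] for the [L^p] norm of [v] on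
    [a B] and [S] for the [L^s] norm of [v] on [lambda B], all of them computed
    with the measure [mu / m] ([scaledLp]), so that no average over a varying
    ball appears any more.

    From local to global.  Fix [1 <= a < lambda] and put
    [a' = (a + lambda) / 2].  By doubling, [a B] is covered by at most [Q] balls
    of radius [t = (lambda - a) rho / 4], each of mass at least [m / Q], where
    [Q = (32 lambda / (lambda - a))^D] for a fixed [D] ([ball_cover],
    [mass_ball_le]).
    Their doubles lie in [a' B], so applying the hypothesis to each of them and
    adding up costs only powers of [Q] ([scaledLp_cover], [scaledLp_mass]):
    [Phi a <= K (lambda - a)^-e (|v|_(L^r(a' B)) + |v|_(L^q(a' B))^alpha)],
    which is [scaledLp_step].

    Interpolation.  By log-convexity of [L^p] norms
    ([scaledLp_interpolation]) the two terms on the right are at most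
    [Phi a' ^ beta1 * S ^ (1 - beta1)] and
    [Phi a' ^ (beta2 alpha) * S ^ ((1 - beta2) alpha)].  Because
    [beta2 alpha = beta1] both carry the same power of [Phi a'], and
    [Phi a <= K W (lambda - a)^-e Phi a' ^ beta1] with
    [W = S ^ (1 - beta1) + S ^ ((1 - beta2) alpha)] ([Phi_step]).

    Absorption.  Since [beta1 < 1], the power of [Phi] on the right is
    sublinear.  With [c = e / (1 - beta1)] the weighted supremum [G] of
    [(lambda - a)^c Phi a] is finite, as [v] is in [L^p(lambda B)], and the
    weight is tuned so that the step becomes [G <= K' W G ^ beta1], that is
    [G <= (K' W) ^ (1 / (1 - beta1))] ([absorption]); this replaces an infinite
    iteration.  Finally [W ^ (1 / (1 - beta1))] is comparable to
    [S + S ^ theta]. *)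

Set Implicit Arguments.
Unset Strict Implicit.
Unset Printing Implicit Defensive.

Import Order.TTheory GRing.Theory Num.Theory.
Import numFieldNormedType.Exports.

Local Open Scope classical_set_scope.
Local Open Scope ring_scope.

(** * Absorption of a sublinear term *)

Section absorption.
Context {R : realType}.
Implicit Types (a b e K l : R) (f : R -> R).

Lemma sublinear_bound K b (g : R) : 0 <= K -> b < 1 -> 0 <= g ->
  g <= K * g `^ b -> g <= K `^ (1 - b)^-1.
Proof.
move=> K0 b1; rewrite le_eqVlt => /predU1P[<-|g0] gK; first exact: powR_ge0.
have b10 : 0 < 1 - b by rewrite subr_gt0.
have gbK : g `^ (1 - b) <= K.
  rewrite powRB ?gt_eqF ?implybT// powRr1 ?(ltW g0)//.
  by rewrite ler_pdivrMr// powR_gt0.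
have -> : g = (g `^ (1 - b)) `^ (1 - b)^-1.
  by rewrite -powRrM divff ?gt_eqF// powRr1// ltW.
by apply: ge0_ler_powR => //; rewrite ?nnegrE ?powR_ge0// invr_ge0 ltW.
Qed.

(** The weighted supremum of [(l - a)^c f a], [c = e / (1 - b)], satisfies a
    self-bounding inequality: halving the distance to [l] only changes the
    weight by the factor [2^c], and [c = e + c b] makes all powers of [l - a]
    cancel.  Boundedness of [f] is what makes this supremum finite. *)
Lemma absorption f (l e b K M : R) :
  1 < l -> 0 <= e -> b < 1 -> 0 <= b -> 0 <= K ->
  (forall a, 1 <= a < l -> 0 <= f a <= M) ->
  (forall a, 1 <= a < l ->
    f a <= K * (l - a) `^ (- e) * f ((a + l) / 2) `^ b) ->
  f 1 <= (l - 1) `^ (- (e / (1 - b))) *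
         (K * 2 `^ (e / (1 - b) * b)) `^ (1 - b)^-1.
Proof.
move=> l1 e0 b1 b0 K0 fM frec.
have b10 : 0 < 1 - b by rewrite subr_gt0.
set c := e / (1 - b).
have c0 : 0 <= c by rewrite divr_ge0// ltW.
pose E : set R := [set (l - a) `^ c * f a | a in [set a | 1 <= a < l]].
have E1 : E ((l - 1) `^ c * f 1) by exists 1 => //=; rewrite lexx.
have ubE : has_ubound E.
  exists ((l - 1) `^ c * M) => _ [a /= /andP[a1 al] <-].
  have /andP[fa0 faM] := fM a (introT andP (conj a1 al)).
  apply: ler_pM => //; first exact: powR_ge0.
  by apply: ge0_ler_powR => //; rewrite ?nnegrE; lra.
have supE : has_sup E by split => //; exists ((l - 1) `^ c * f 1).
set G := sup E.
have leG a : 1 <= a < l -> (l - a) `^ c * f a <= G.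
  by move=> al; apply: ub_le_sup => //; exists a.
have G0 : 0 <= G.
  apply: le_trans (leG 1 _); last by rewrite lexx.
  by rewrite mulr_ge0 ?powR_ge0//; case/andP: (fM 1 (introT andP (conj (lexx _) l1))).
have GG : G <= K * 2 `^ (c * b) * G `^ b.
  apply: ge_sup; first by exists ((l - 1) `^ c * f 1).
  move=> _ [a /= /andP[a1 al] <-].
  have la0 : 0 < l - a by rewrite subr_gt0.
  set a' := (a + l) / 2.
  have al' : 1 <= a' < l by rewrite /a'; apply/andP; split; lra.
  have la' : l - a' = (l - a) / 2 by rewrite /a'; lra.
  have fa'0 : 0 <= f a' by case/andP: (fM a' al').
  have fa' : f a' <= (l - a) `^ (- c) * 2 `^ c * G.
    have := leG a' al'; rewrite la' powRM ?invr_ge0 ?(ltW la0)// => h.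
    have -> : 2 `^ c = (2^-1 `^ c)^-1 :> R.
      by rewrite -[in RHS](@powR_inv1 _ 2)// -powRrM mulN1r powRN invrK.
    rewrite powRN -invfM mulrC ler_pdivlMr ?mulr_gt0 ?powR_gt0//.
    by rewrite mulrC.
  have fa'b : f a' `^ b <= (l - a) `^ (- c * b) * 2 `^ (c * b) * G `^ b.
    have -> : (l - a) `^ (- c * b) * 2 `^ (c * b) * G `^ b =
              ((l - a) `^ (- c) * 2 `^ c * G) `^ b.
      by rewrite !powRM ?mulr_ge0 ?powR_ge0// -!powRrM.
    by apply: ge0_ler_powR => //; rewrite nnegrE ?fa'0// !mulr_ge0 ?powR_ge0.
  (* the choice of [c] makes the total power of [l - a] vanish *)
  have la1 : (l - a) `^ c * ((l - a) `^ (- e) * (l - a) `^ (- c * b)) = 1.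
    rewrite -!powRD ?(gt_eqF la0) ?implybT//.
    have -> : c + (- e + - c * b) = 0 by rewrite /c; field; rewrite gt_eqF.
    by rewrite powRr0.
  have := frec a (introT andP (conj a1 al)).
  rewrite -/a' => /le_trans h.
  have {}h : f a <= K * (l - a) `^ (- e) *
      ((l - a) `^ (- c * b) * 2 `^ (c * b) * G `^ b).
    by apply: h; rewrite ler_wpM2l// mulr_ge0 ?powR_ge0.
  apply: (le_trans (ler_wpM2l (powR_ge0 _ _) h)).
  rewrite le_eqVlt; apply/orP; left; apply/eqP.
  rewrite -[RHS]mul1r -la1; ring.
have := sublinear_bound _ b1 G0 GG; rewrite mulr_ge0 ?powR_ge0// => /(_ isT) h.
rewrite powRN mulrC ler_pdivlMr ?powR_gt0 ?subr_gt0// mulrC.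
by apply: le_trans h; apply: leG; rewrite lexx.
Qed.

Lemma powRD_le (x y c : R) : 0 <= x -> 0 <= y -> 0 <= c ->
  (x + y) `^ c <= 2 `^ c * (x `^ c + y `^ c).
Proof.
move=> x0 y0 c0.
wlog xy : x y x0 y0 / x <= y.
  move=> h; case/orP: (le_total x y) => ?; first exact: h.
  by rewrite addrC [X in _ * X]addrC; exact: h.
apply: (@le_trans _ _ ((2 * y) `^ c)).
  by apply: ge0_ler_powR => //; rewrite ?nnegrE; lra.
by rewrite powRM// ler_wpM2l ?powR_ge0// lerDr powR_ge0.
Qed.

End absorption.

(** * Covering balls in a doubling space *)

(** Counts the doublings needed to reach a ratio [z] while losing at most a
    factor [2]. *)
Lemma pow2_between {R : realType} (z : R) :
  1 <= z -> exists n, z <= 2 ^+ n <= 2 * z.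
Proof.
move=> z1; have ex : exists n, z <= 2 ^+ n :> R.
  have := @truncnS_gt _ z; set k := (Num.truncn z).+1 => zk.
  exists k; apply: (le_trans (ltW zk)).
  by rewrite -natrX ler_nat ltnW// ltn_expl.
exists (ex_minn ex); case: ex_minnP => -[|n] zn nmin; rewrite zn/=.
  by rewrite expr0; lra.
rewrite exprS ler_pM2l// leNgt; apply/negP => /ltW /nmin.
by rewrite ltnn.
Qed.

Section doubling_geometry.
Context {R : realType} {d : measure_display} {M : metricMeasurableType R d}.
Implicit Types (x y z : M) (r t : R) (l : seq M).

(** Balls of a general pseudometric space need not be open; the triangle
    inequality at strict radii, available for [mdist], makes these open. *)
Lemma open_metric_ball x r : open (ball x r).
Proof.
rewrite openE => y /=; rewrite ballEmdist/= => xy.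
apply/nbhs_ballP; exists (r - mdist x y) => /=; first by rewrite subr_gt0.
move=> z; rewrite !ballEmdist/= => yz.
by apply: (le_lt_trans (metric_triangle x y z)); lra.
Qed.

Lemma measurable_metric_ball x r : measurable (ball x r).
Proof. exact/open_measurable_metric/open_metric_ball. Qed.

Lemma sub_ball_shift x y r t u : ball x r y -> r + t <= u -> ball y t `<=` ball x u.
Proof. by move=> xy rtu z yz; apply: (le_ball rtu); apply: ball_triangle yz. Qed.

Definition separated t l := pairwise (fun y z => t <= mdist y z) l.

(** A separated set that fails to cover can be enlarged by an uncovered point.
    Hence, as long as no separated set covers, there are separated sets of
    every size; a bound on their size then produces a finite cover. *)
Lemma separated_extend (E : set M) t :
  (forall l, (forall y, y \in l -> E y) -> separated t l ->
     ~ (E `<=` \bigcup_(y in [set` l]) ball y t)) ->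
  forall n, exists l, [/\ size l = n, forall y, y \in l -> E y & separated t l].
Proof.
move=> h; elim=> [|n [l [ln lE lsep]]]; first by exists [::].
have /nonsubset[z [Ez zl]] := h l lE lsep.
exists (z :: l); split; first by rewrite /= ln.
  by move=> y; rewrite in_cons => /predU1P[->//|]; exact: lE.
rewrite /separated pairwise_cons; apply/andP; split => //.
apply/allP => y yl; rewrite leNgt; apply/negP => zy; apply: zl.
by exists y => //; rewrite ballEmdist/= metric_sym.
Qed.

Local Open Scope ereal_scope.
Variable mu : {measure set M -> \bar R}.

(** Balls of half the separation radius are disjoint, so their masses add up
    inside [F]. *)
Lemma separated_packing t l (c : R) (F : set M) : (0 < t)%R ->
  separated t l -> measurable F ->
  (forall y, y \in l -> ball y (t / 2) `<=` F) ->
  (forall y, y \in l -> c%:E <= mu (ball y (t / 2))) ->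
  ((size l)%:R * c)%:E <= mu F.
Proof.
move=> t0 lsep mF lF lc.
have mU (l' : seq M) : measurable (\bigcup_(y in [set` l']) ball y (t / 2)).
  by apply: fin_bigcup_measurable => // y _; exact: measurable_metric_ball.
apply: (@le_trans _ _ (mu (\bigcup_(y in [set` l]) ball y (t / 2)))); last first.
  by apply: le_measure; rewrite ?inE// => z [y yl]; exact: lF.
elim: l lsep {lF} lc => [|y l ih]; first by rewrite mul0r measure_ge0.
rewrite /separated pairwise_cons => /andP[/allP yl lsep] lc.
rewrite bigcup_seq big_cons -bigcup_seq.
rewrite measureU//; [|exact: measurable_metric_ball|].
  rewrite /= -natr1 mulrDl mul1r addrC EFinD leeD//; first by rewrite lc ?mem_head.
  by apply: ih => // z zl; rewrite lc// in_cons zl orbT.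
apply/seteqP; split => // z [yz [u ul uz]].
have := yl u ul; rewrite leNgt => /negP; apply.
move: yz uz; rewrite !ballEmdist/= => yz uz.
apply: (le_lt_trans (metric_triangle y z u)).
by rewrite (metric_sym z u) [t]splitr ltrD.
Qed.

Variable C : R.
Hypothesis dblC : doubling mu C.

Lemma doubling_fin x r : (0 < r)%R -> mu (ball x r) \is a fin_num.
Proof. by move=> r0; case/andP: (dblC.1 x r r0) => h1 h2; rewrite ge0_fin_numE// ltW. Qed.

Lemma doubling_ball_gt0 x r : (0 < r)%R -> 0 < mu (ball x r).
Proof. by move=> r0; case/andP: (dblC.1 x r r0). Qed.

(** The doubling hypothesis covers radii below the diameter only.  For a larger
    radius [r] the ball of radius [2 r] is the whole space, which already is the
    double of the ball of radius [3/4] of the diameter, unless the diameter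
    vanishes and all balls are equal. *)
Lemma doubling_large C' x r : (C <= C')%R -> (1 <= C')%R -> (0 < r)%R ->
  mu (ball x (2 * r)) <= C'%:E * mu (ball x r).
Proof.
move=> CC' C'1 r0; have mdiam y z : (mdist y z)%:E <= diameter M.
  by apply: ereal_sup_ubound; exists y, z.
have [rd|] := ltP r%:E (diameter M).
  apply: (le_trans (dblC.2 x r r0 rd)).
  by apply: lee_wpmul2r => //; rewrite lee_fin.
case D : (diameter M) mdiam => [D'| |] mdiam; last 2 first.
- by rewrite leye_eq.
- by have := mdiam x x; rewrite leeNy_eq.
rewrite lee_fin => D'r.
have [D'0|D'0] := leP D' 0%R.
  apply: (@le_trans _ _ (mu (ball x r))); last first.
    by rewrite -[leLHS]mul1e; apply: lee_wpmul2r => //; rewrite lee_fin.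
  apply: le_measure; rewrite ?inE; [exact: measurable_metric_ball..|].
  move=> y _; rewrite ballEmdist/=; have := mdiam x y; rewrite lee_fin; lra.
(* any radius strictly between [D' / 2] and [D'] would do *)
pose r' := (3 / 4 * D')%R.
have r'0 : (0 < r')%R by rewrite /r'; lra.
apply: (@le_trans _ _ (mu (ball x (2 * r')))).
  apply: le_measure; rewrite ?inE; [exact: measurable_metric_ball..|].
  move=> y _; rewrite ballEmdist/=; have := mdiam x y; rewrite lee_fin /r'; lra.
apply: (le_trans (dblC.2 x r' r'0 _)); first by rewrite D lte_fin /r'; lra.
apply: (@le_trans _ _ (C'%:E * mu (ball x r'))).
  by apply: lee_wpmul2r => //; rewrite lee_fin.
apply: lee_wpmul2l; first by rewrite lee_fin; lra.
apply: le_measure; rewrite ?inE; [exact: measurable_metric_ball..|].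
by apply: le_ball; rewrite /r'; lra.
Qed.

Lemma doubling_iter (D : nat) x r n : (C <= 2 ^+ D)%R -> (0 < r)%R ->
  mu (ball x (2 ^+ n * r)) <= ((2 ^+ n) ^+ D)%:E * mu (ball x r).
Proof.
move=> CD r0; elim: n => [|n ih].
  by rewrite !expr0 expr1n mul1r mul1e.
rewrite !exprS -mulrA.
apply: (le_trans (doubling_large x CD _ _)); first by rewrite exprn_ege1// ler1n.
  by rewrite mulr_gt0// exprn_gt0.
by rewrite exprMn EFinM -muleA lee_wpmul2l// lee_fin exprn_ge0.
Qed.

Lemma doubling_ratio (D : nat) x r t : (C <= 2 ^+ D)%R -> (0 < r)%R -> (r <= t)%R ->
  mu (ball x t) <= ((2 * t / r) ^+ D)%:E * mu (ball x r).
Proof.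
move=> CD r0 rt.
have [|n /andP[n1 n2]] := @pow2_between _ (t / r)%R; first by rewrite ler_pdivlMr// mul1r.
apply: (@le_trans _ _ (mu (ball x (2 ^+ n * r)))).
  apply: le_measure; rewrite ?inE; [exact: measurable_metric_ball..|].
  by apply: le_ball; rewrite -ler_pdivrMr.
apply: (le_trans (doubling_iter x n CD r0)).
apply: lee_wpmul2r => //; rewrite lee_fin lerXn2r ?nnegrE ?exprn_ge0//.
  by rewrite !mulr_ge0// ?invr_ge0; lra.
by rewrite -mulrA.
Qed.

(** All small balls centred in [ball x (a * rho)] carry a fixed share of the mass
    of the large ball, polynomial in the gap [l - a].  The radius is half of the
    one in [ball_cover], as needed for disjoint balls in a packing. *)
Lemma mass_ball_le (D : nat) x y (rho a l : R) :
  (C <= 2 ^+ D)%R -> (0 < rho)%R -> (1 <= a < l)%R -> ball x (a * rho) y ->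
  mu (ball x (l * rho)) <=
  ((32 * l / (l - a)) ^+ D)%:E * mu (ball y ((l - a) / 8 * rho)).
Proof.
move=> CD rho0 /andP[a1 al] xy.
apply: (@le_trans _ _ (mu (ball y (2 * (l * rho))))).
  apply: le_measure; rewrite ?inE; [exact: measurable_metric_ball..|].
  by apply: (sub_ball_shift (ball_sym xy)); nra.
have r0 : (0 < (l - a) / 8 * rho)%R by rewrite mulr_gt0//; lra.
apply: (le_trans (doubling_ratio y CD r0 _)); first by nra.
rewrite le_eqVlt; apply/orP; left; apply/eqP; congr ((_ ^+ _)%:E * _).
by field; rewrite ?gt_eqF//; lra.
Qed.

(** The centres form a maximal separated set: by [mass_ball_le] and
    [separated_packing] the size of separated sets is bounded, hence
    [separated_extend] cannot go on forever. *)
Lemma ball_cover (D : nat) x (rho a l : R) :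
  (C <= 2 ^+ D)%R -> (0 < rho)%R -> (1 <= a < l)%R ->
  exists s : seq M, [/\ forall y, y \in s -> ball x (a * rho) y,
    ball x (a * rho) `<=` \bigcup_(y in [set` s]) ball y ((l - a) / 4 * rho) &
    ((size s)%:R <= (32 * l / (l - a)) ^+ D)%R].
Proof.
move=> CD rho0 /andP[a1 al]; set t := ((l - a) / 4 * rho)%R.
have t0 : (0 < t)%R by rewrite /t mulr_gt0// divr_gt0// subr_gt0.
set Q := ((32 * l / (l - a)) ^+ D)%R.
have Q0 : (0 < Q)%R by rewrite exprn_gt0// divr_gt0; lra.
have packed s : (forall y, y \in s -> ball x (a * rho) y) -> separated t s ->
    ((size s)%:R <= Q)%R.
  move=> sx ssep.
  have lrho : (0 < l * rho)%R by rewrite mulr_gt0//; lra.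
  have mF := doubling_fin x lrho.
  set m := fine (mu (ball x (l * rho))).
  have m0 : (0 < m)%R by rewrite fine_gt0// doubling_ball_gt0//= ltey_eq mF.
  have := @separated_packing t s (m / Q) (ball x (l * rho)) t0 ssep
    (measurable_metric_ball _ _).
  rewrite -[X in _ -> _ -> _ <= X]fineK// lee_fin -/m mulrA ler_pdivrMr//.
  rewrite [X in (X <= _)%R]mulrC ler_pM2l//.
  apply => y /sx xy.
    by apply: (sub_ball_shift xy); rewrite /t; nra.
  rewrite mulrC EFinM lee_pdivrMl// fineK//.
  have -> : (t / 2 = (l - a) / 8 * rho)%R by rewrite /t; field.
  by apply: mass_ball_le => //; rewrite a1.
apply: contrapT => nos.
have [|s [sn sx ssep]] := @separated_extend (ball x (a * rho)) t _ (Num.truncn Q).+1.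
  by move=> s sx ssep cov; apply: nos; exists s; split => //; exact: packed.
have := packed s sx ssep; rewrite sn leNgt => /negP; apply.
exact: truncnS_gt.
Qed.

End doubling_geometry.

(** * Lebesgue norms for a multiple of the measure *)

Section weighted_norm.
Context {R : realType} {d : measure_display} {T : measurableType d}.
Variable mu : {measure set T -> \bar R}.
Local Open Scope ereal_scope.
Implicit Types (E F : set T) (m : R) (p : \bar R).

(** The norm of [L^p(E)] for the measure [mu / m].  With [m = mu E] this is
    [Lavg]; keeping [m] fixed while [E] varies gives norms that are
    monotone in [E]. *)
Definition scaledLp m p E (f : T -> R) : \bar R :=
  match p with
  | p%:E => (m^-1%:E * \int[mu]_(x in E) ((f x `^ p)%R)%:E) `^ p^-1
  | +oo => ess_sup mu (EFin \o (f \_ E))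
  | -oo => 0
  end.

Lemma Lavg_scaledLp p E f : mu E \is a fin_num -> 0 < mu E ->
  Lavg mu p E f = scaledLp (fine (mu E)) p E f.
Proof.
move=> muE E0; case: p => //= p; rewrite /avg; congr ((_ * _) `^ _).
rewrite -[in LHS](fineK muE) inver ifF//.
by rewrite gt_eqF// fine_gt0// E0 ltey_eq muE.
Qed.

Variable f : T -> R.
Hypothesis mf : measurable_fun setT f.
Hypothesis f0 : forall x, (0 <= f x)%R.
Hypothesis muT0 : 0 < mu setT.

Lemma ess_sup_restrict_le E y : 0 <= y ->
  ess_sup mu (EFin \o (f \_ E)) <= y <-> {ae mu, forall x, E x -> (f x)%:E <= y}.
Proof.
move=> y0; split.
  move=> /ess_supP; apply: filterS => x /= + Ex.
  by rewrite patchT ?inE.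
move=> h; apply/ess_supP; apply: filterS h => x /= h.
by rewrite patchE; case: ifPn => // /set_mem /h.
Qed.

Lemma measurable_powRf (e : R) E : measurable E ->
  measurable_fun E (EFin \o (fun x => f x `^ e)%R).
Proof.
move=> mE; apply: measurable_funTS; apply/measurable_EFinP.
exact: (@measurableT_comp _ _ _ _ _ _ (@powR R ^~ e)).
Qed.

Lemma powRf_ge0 (e : R) x : 0 <= ((f x `^ e)%R)%:E.
Proof. by rewrite lee_fin powR_ge0. Qed.
Local Hint Resolve powRf_ge0 : core.

Lemma integral_powRf_ge0 (e : R) E : 0 <= \int[mu]_(x in E) ((f x `^ e)%R)%:E.
Proof. exact: integral_ge0. Qed.
Local Hint Resolve integral_powRf_ge0 : core.

Lemma scaledLp_ge0 m p E : 0 <= scaledLp m p E f.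
Proof.
case: p => [p||] //=; first exact: poweR_ge0.
apply: ess_sup_gee => //; apply/nearW => x /=.
by rewrite lee_fin patchE; case: ifP.
Qed.
Local Hint Resolve scaledLp_ge0 : core.

Lemma lee_poweR (x y : \bar R) (e : R) : (0 <= e)%R -> 0 <= x -> x <= y ->
  x `^ e <= y `^ e.
Proof.
move=> e0 x0 xy; apply: gt0_ler_poweR => //; rewrite in_itv/= leey andbT//.
exact: le_trans xy.
Qed.

Lemma scaledLp_sub m p E F : (0 < m)%R -> 0 < p -> measurable E -> measurable F ->
  E `<=` F -> scaledLp m p E f <= scaledLp m p F f.
Proof.
move=> m0; case: p => [p||] //= p0 mE mF EF; last first.
  apply/ess_sup_restrict_le; first exact: (scaledLp_ge0 m +oo).
  have /ess_sup_restrict_le := lexx (ess_sup mu (EFin \o (f \_ F))).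
  move=> /(_ (scaledLp_ge0 m +oo F)); apply: filterS => x h Ex; exact/h/EF.
apply: lee_poweR.
- by rewrite invr_ge0 ltW.
- by rewrite mule_ge0// lee_fin invr_ge0 ltW.
- apply: lee_wpmul2l; first by rewrite lee_fin invr_ge0 ltW.
  by apply: ge0_subset_integral => //; exact: measurable_powRf.
Qed.

(** The natural constant is [Q ^ (1 / p)], to be read as [1] when [p] is infinite;
    the larger [Q ^ (1 / s)] serves all exponents [p >= s] at once. *)
Lemma scaledLp_mass (s : R) Q m m' p E : (0 < s)%R -> s%:E <= p -> (1 <= Q)%R ->
  (0 < m)%R -> (0 < m')%R -> (m <= Q * m')%R ->
  scaledLp m' p E f <= (Q `^ s^-1)%R%:E * scaledLp m p E f.
Proof.
move=> s0 + Q1 m0 m'0 mm'; case: p => [p||] //=; last first.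
  move=> _; rewrite -[leLHS]mul1e lee_wpmul2r//; first exact: (scaledLp_ge0 m +oo).
  by rewrite lee_fin -[leLHS](powRr0 Q) ler_powR// invr_ge0 ltW.
rewrite lee_fin => sp; have p0 := lt_le_trans s0 sp.
set I := \int[mu]_(_ in _) _; have I0 : 0 <= I by exact: integral_powRf_ge0.
apply: (@le_trans _ _ ((Q%:E * (m^-1%:E * I)) `^ p^-1)).
  apply: lee_poweR; first by rewrite invr_ge0 ltW.
    by rewrite mule_ge0// lee_fin invr_ge0 ltW.
  rewrite muleA -EFinM lee_wpmul2r// lee_fin.
  by rewrite ler_pdivlMr// mulrC ler_pdivrMr.
rewrite poweRM ?lee_fin//; [|lra|by rewrite mule_ge0// lee_fin invr_ge0 ltW].
rewrite poweR_EFin lee_wpmul2r ?poweR_ge0// lee_fin ler_powR//.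
by rewrite lef_pV2 ?posrE.
Qed.

Lemma integral_bigcup_le (I : choiceType) (l : seq I) (B : I -> set T)
    (g : T -> \bar R) :
  measurable_fun setT g -> (forall x, 0 <= g x) ->
  (forall i, i \in l -> measurable (B i)) ->
  \int[mu]_(x in \bigcup_(i in [set` l]) B i) g x <=
  \sum_(i <- l) \int[mu]_(x in B i) g x.
Proof.
move=> mg g0; rewrite bigcup_seq; elim: l => [|i l ih] mB.
  by rewrite !big_nil integral_set0.
have mU : measurable (\big[setU/set0]_(j <- l) B j).
  rewrite big_seq; apply: bigsetU_measurable => j jl.
  by apply: mB; rewrite in_cons jl orbT.
have mBi : measurable (B i) by apply: mB; rewrite mem_head.
set U := \big[setU/set0]_(j <- l) B j in mU ih *.
have mUB : measurable ((B i `|` U) `\` B i).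
  by apply: measurableD => //; exact: measurableU.
rewrite !big_cons -/U -(@setDUK _ (B i) (B i `|` U)); last exact: subsetUl.
rewrite ge0_integral_setU//; last 2 first.
- exact: measurable_funTS.
- by apply/disj_setPS => x [Bi []].
apply: leeD => //; apply: le_trans (ih _); last first.
  by move=> j jl; apply: mB; rewrite in_cons jl orbT.
apply: ge0_subset_integral => //; first exact: measurable_funTS.
by move=> x [[]].
Qed.

(** From local to global: the [p]-th powers of the norms add up over the pieces
    (for infinite [p] one takes a maximum), and the number of pieces is paid for
    by [Q ^ (1 / s)]. *)
Lemma scaledLp_cover (I : choiceType) (l : seq I) (B : I -> set T) (k : I -> R)
    E m Q (s : R) p (X : \bar R) :
  (0 < s)%R -> s%:E <= p -> (0 < m)%R -> (1 <= Q)%R -> ((size l)%:R <= Q)%R ->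
  0 <= X -> measurable E -> E `<=` \bigcup_(i in [set` l]) B i ->
  (forall i, i \in l -> [/\ measurable (B i), (0 < k i <= m)%R &
     scaledLp (k i) p (B i) f <= X]) ->
  scaledLp m p E f <= (Q `^ s^-1)%R%:E * X.
Proof.
move=> s0 + m0 Q1 lQ X0 mE El Bl; case: p Bl => [p||] //= Bl; last first.
  move=> _; apply: (@le_trans _ _ X); last first.
    rewrite -[leLHS]mul1e lee_wpmul2r//.
    by rewrite lee_fin -[leLHS](powRr0 Q) ler_powR// invr_ge0 ltW.
  apply/ess_sup_restrict_le => //.
  have : {ae mu, forall x, forall i, i \in l -> B i x -> (f x)%:E <= X}.
    elim: l Bl {lQ El} => [|i l ih] Bl; first exact/nearW.
    have /ih h : forall j, j \in l -> [/\ measurable (B j), (0 < k j <= m)%R &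
        ess_sup mu (EFin \o (f \_ (B j))) <= X].
      by move=> j jl; apply: Bl; rewrite in_cons jl orbT.
    have [_ _ /ess_sup_restrict_le] := Bl i (mem_head _ _).
    move=> /(_ X0); apply: filterS2 h => x h hi j.
    by rewrite in_cons => /predU1P[->//|]; exact: h.
  by apply: filterS => x h /El[i il Bi]; apply: h Bi.
rewrite lee_fin => sp; have p0 := lt_le_trans s0 sp.
apply: (@le_trans _ _ ((Q%:E * X `^ p) `^ p^-1)); last first.
  rewrite poweRM ?poweR_ge0 ?lee_fin//; last lra.
  rewrite -poweRrM divff ?gt_eqF// poweRe1// poweR_EFin lee_wpmul2r//.
  by rewrite lee_fin ler_powR// lef_pV2 ?posrE.
apply: lee_poweR.
- by rewrite invr_ge0 ltW.
- by rewrite mule_ge0// lee_fin invr_ge0 ltW.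
rewrite lee_pdivrMl//.
have mU : measurable (\bigcup_(i in [set` l]) B i).
  by apply: fin_bigcup_measurable => // i /= il; have [] := Bl i il.
apply: (@le_trans _ _
    (\int[mu]_(x in \bigcup_(i in [set` l]) B i) ((f x `^ p)%R)%:E)).
  by apply: ge0_subset_integral => //; exact: measurable_powRf.
apply: (le_trans (integral_bigcup_le (measurable_powRf p measurableT) _ _)).
- by move=> x; exact: powRf_ge0.
- by move=> i /Bl[].
apply: (@le_trans _ _ (\sum_(i <- l) (m%:E * X `^ p))).
  rewrite !big_seq; apply: lee_sum => i il.
  have [_ /andP[k0 km] BX] := Bl i il.
  have : (k i)^-1%:E * \int[mu]_(x in B i) ((f x `^ p)%R)%:E <= X `^ p.
    rewrite -[leLHS]poweRe1 ?mule_ge0 ?lee_fin ?invr_ge0 ?(ltW k0)//.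
    rewrite -(@mulVf _ p) ?gt_eqF// poweRrM; apply: lee_poweR => //; first exact: ltW.
    exact: poweR_ge0.
  rewrite lee_pdivrMl// => /le_trans; apply.
  by rewrite lee_wpmul2r ?poweR_ge0 ?lee_fin.
have -> : \sum_(i <- l) (m%:E * X `^ p) = (size l)%:R%:E * (m%:E * X `^ p).
  elim: (l) => [|i l' ih]; first by rewrite big_nil mul0e.
  rewrite big_cons ih /= -natr1 EFinD ge0_muleDl ?lee_fin ?ler0n//.
  by rewrite mul1e addeC.
rewrite muleCA lee_wpmul2l ?lee_fin ?(ltW m0)//.
by rewrite lee_wpmul2r ?poweR_ge0 ?lee_fin.
Qed.

(** Hoelder's inequality for the conjugate exponents [1 / a] and [1 / b]. *)
Lemma integral_powR_log_convex (a b e1 e2 : R) E : measurable E ->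
  (0 < a)%R -> (0 < b)%R -> (a + b = 1)%R -> (0 < e1)%R -> (0 < e2)%R ->
  \int[mu]_(x in E) ((f x `^ (a * e1 + b * e2))%R)%:E <=
  (\int[mu]_(x in E) ((f x `^ e1)%R)%:E) `^ a *
  (\int[mu]_(x in E) ((f x `^ e2)%R)%:E) `^ b.
Proof.
move=> mE a0 b0 ab e10 e20.
have mfE (c : R) : measurable_fun setT ((fun x => (f x `^ c)%R) \_ E).
  apply/(measurable_restrictT _ mE).1; apply: measurable_funTS.
  exact: (@measurableT_comp _ _ _ _ _ _ (@powR R ^~ c)).
have NfE (c e : R) : (0 < c)%R ->
    Lnorm mu c^-1%:E (EFin \o ((fun x => (f x `^ (c * e))%R) \_ E)) =
    (\int[mu]_(x in E) ((f x `^ e)%R)%:E) `^ c.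
  move=> c0; rewrite unlock invrK [in RHS]integral_mkcond; congr (_ `^ _).
  apply: eq_integral => x _; rewrite /= !patchE; case: ifPn => xE /=.
    by rewrite ger0_norm ?powR_ge0// -powRrM mulrAC divff ?mul1r// gt_eqF.
  by rewrite normr0 powR0// invr_eq0 gt_eqF.
rewrite -NfE// -NfE//; apply: le_trans (hoelder _ _ _ _ _ _) => //;
  rewrite ?invr_gt0// ?invrK//.
rewrite Lnorm1 integral_mkcond le_eqVlt; apply/orP; left; apply/eqP.
apply: eq_integral => x _; rewrite /= !patchE; case: ifPn => xE /=.
  rewrite ger0_norm ?mulr_ge0 ?powR_ge0// powRD//.
  by rewrite gt_eqF// addr_gt0// mulr_gt0.
by rewrite mulr0 normr0.
Qed.

(** The common factor [1 / m] spreads over both norms because the two Hoelder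
    exponents add up to [1].  For infinite [p], where [s = r (1 - b)], the
    integrand [f ^ r] is bounded by [N ^ (r b) * f ^ s] almost everywhere, [N]
    being the essential supremum. *)
Lemma scaledLp_interpolation m (r s b : R) p E : measurable E -> (0 < m)%R ->
  (0 < s)%R -> (0 < r)%R -> 0 < p -> (0 < b < 1)%R ->
  r^-1%:E = b%:E * p^-1 + (1 - b)%:E * s^-1%:E ->
  scaledLp m p E f < +oo ->
  scaledLp m r%:E E f <= scaledLp m p E f `^ b * scaledLp m s%:E E f `^ (1 - b).
Proof.
move=> mE m0 s0 r0 + /andP[b0 b1].
have b10 : (0 < 1 - b)%R by rewrite subr_gt0.
have minv0 : 0 <= m^-1%:E by rewrite lee_fin invr_ge0 ltW.
case: p => [p||] //.
  rewrite lte_fin => p0; rewrite inver gt_eqF// -!EFinM -EFinD => -[rE] _.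
  pose a := (r * (b / p))%R; pose c := (r * ((1 - b) / s))%R.
  have a0 : (0 < a)%R by rewrite mulr_gt0// divr_gt0.
  have c0 : (0 < c)%R by rewrite mulr_gt0// divr_gt0.
  have ac : (a + c = 1)%R by rewrite -mulrDr -rE divff// gt_eqF.
  have racE : r = (a * p + c * s)%R.
    by rewrite /a /c; field; rewrite !gt_eqF.
  have := integral_powR_log_convex mE a0 c0 ac p0 s0; rewrite -racE.
  rewrite /scaledLp; set Ir := \int[mu]_(_ in _) _; set Ip := \int[mu]_(_ in _) _.
  set Is := \int[mu]_(_ in _) _ => Ile.
  have Ir0 : 0 <= Ir by exact: integral_powRf_ge0.
  have Ip0 : 0 <= Ip by exact: integral_powRf_ge0.
  have Is0 : 0 <= Is by exact: integral_powRf_ge0.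
  apply: (@le_trans _ _ (((m^-1%:E * Ip) `^ a * (m^-1%:E * Is) `^ c) `^ r^-1)).
    apply: lee_poweR; [by rewrite invr_ge0 ltW|exact: mule_ge0|].
    rewrite !poweRM// muleACA -poweRD; last first.
      by rewrite add_neq0_poweRD_def// ac oner_eq0.
    by rewrite ac poweRe1// lee_wpmul2l.
  rewrite poweRM ?poweR_ge0// -!poweRrM le_eqVlt; apply/orP; left; apply/eqP.
  by congr (_ `^ _ * _ `^ _); rewrite /a /c; field; rewrite !gt_eqF.
move=> _; rewrite invey mule0 add0e -EFinM => -[rE].
set N := scaledLp m +oo E f => Noo.
have N0 : 0 <= N by exact: scaledLp_ge0.
have Nfin : N \is a fin_num by rewrite ge0_fin_numE.
have sr : (s = r * (1 - b))%R.
  have : (r * r^-1 = r * ((1 - b) / s))%R by rewrite rE.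
  rewrite divff ?gt_eqF// mulrA => /esym/(canRL (divfK _)) => ->.
    by rewrite mul1r.
  by rewrite gt_eqF.
have fN := (ess_sup_restrict_le E N0).1 (lexx _).
have IrN : \int[mu]_(x in E) ((f x `^ r)%R)%:E <=
    N `^ (r * b) * \int[mu]_(x in E) ((f x `^ s)%R)%:E.
  rewrite -ge0_integralZl//; [|exact: measurable_powRf|exact: poweR_ge0].
  apply: ae_ge0_le_integral => //.
  - exact: measurable_powRf.
  - by move=> x _; rewrite mule_ge0// poweR_ge0.
  - by apply: measurable_funeM; exact: measurable_powRf.
  apply: filterS fN => x /[apply] fxN.
  have rE' : r = (r * b + s)%R by rewrite sr; ring.
  rewrite [in leLHS]rE' powRD.
    rewrite EFinM lee_wpmul2r//.
    rewrite -poweR_EFin; apply: lee_poweR; rewrite ?lee_fin//.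
    by rewrite mulr_ge0 ?(ltW r0) ?(ltW b0).
  by rewrite gt_eqF// addr_gt0// mulr_gt0.
rewrite /scaledLp; set Is := \int[mu]_(x in E) ((f x `^ s)%R)%:E in IrN *.
have Is0 : 0 <= Is by exact: integral_powRf_ge0.
apply: (@le_trans _ _ ((N `^ (r * b) * (m^-1%:E * Is)) `^ r^-1)).
  apply: lee_poweR; [by rewrite invr_ge0 ltW|exact: mule_ge0|].
  by rewrite muleCA lee_wpmul2l.
rewrite poweRM ?poweR_ge0 ?mule_ge0// -!poweRrM le_eqVlt; apply/orP; left; apply/eqP.
by congr (_ `^ _ * _ `^ _); rewrite ?sr; field; rewrite !gt_eqF.
Qed.

End weighted_norm.

Section averages_extra.
Context {R : realType} {d : measure_display} {T : measurableType d}.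
Variable mu : {measure set T -> \bar R}.
Local Open Scope ereal_scope.
Implicit Types (E : set T) (p : \bar R) (f g : T -> R).

Lemma eq_avg E f g : (forall x, E x -> f x = g x) -> avg mu E f = avg mu E g.
Proof.
move=> fg; rewrite /avg; congr (_ * _); apply: eq_integral => x /set_mem Ex.
by rewrite fg.
Qed.

Lemma eq_Lavg p E f g : (forall x, E x -> f x = g x) -> Lavg mu p E f = Lavg mu p E g.
Proof.
move=> fg; case: p => [p||]; rewrite /Lavg.
- by rewrite (@eq_avg _ _ (fun x => g x `^ p)%R)// => x Ex; rewrite fg.
- have -> // : f \_ E = g \_ E.
  by apply/funext => x; rewrite !patchE; case: ifPn => // /set_mem /fg.
- by [].
Qed.

Lemma avg_poweR E f (e c : R) :
  avg mu E (fun x => f x `^ e)%R `^ (c / e) = (Lavg mu e%:E E f) `^ c.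
Proof. by rewrite /= -poweRrM mulrC. Qed.

Lemma finite_norm_scaledLp m p E f : 0 < mu setT -> (0 < m)%R -> 0 < p ->
  finite_norm mu p (f \_ E) -> (forall x, (0 <= f x)%R) -> scaledLp mu m p E f < +oo.
Proof.
move=> T0 m0 + + f0; rewrite /finite_norm unlock; case: p => [p||] //=.
  rewrite lte_fin => p0 fin; apply: poweR_lty.
  rewrite lte_mul_pinfty ?lee_fin ?invr_ge0 ?(ltW m0)//.
  have := lty_poweRy _ fin; rewrite invr_eq0 gt_eqF// => /(_ isT).
  rewrite [in X in _ -> X]integral_mkcond; congr (_ < _); apply: eq_integral => x _.
  rewrite /= !patchE; case: ifPn => xE /=; first by rewrite ger0_norm.
  by rewrite normr0 powR0// gt_eqF.
move=> _; rewrite T0; congr (_ < _); congr (ess_sup mu _); apply/funext => x /=.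
by rewrite ger0_norm// patchE; case: ifPn.
Qed.

End averages_extra.

(** * Self-improvement on a ball *)

(** The factors come, in this order, from comparing the averages over [B] with
    norms scaled by the mass of [l B], from [absorption] (two factors), and from
    [powRD_le]. *)
Definition improvement_const {R : realType} (D : nat) (l A s alpha b : R) : R :=
  let e := D%:R * ((1 + alpha) / s) in
  ((2 * l) ^+ D) `^ s^-1 * (l - 1) `^ (- (e / (1 - b))) *
  (A * (32 * l) `^ e * 2 `^ (e / (1 - b) * b)) `^ (1 - b)^-1 *
  2 `^ (1 - b)^-1.

Section self_improvement.
Context {R : realType} {d : measure_display} {M : metricMeasurableType R d}.
Variables (mu : {measure set M -> \bar R}) (C : R) (D : nat).
Hypotheses (dblC : doubling mu C) (CD : C <= 2 ^+ D).
Variables (x : M) (rho l A : R).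
Hypotheses (rho0 : 0 < rho) (l1 : 1 < l) (A0 : 0 < A).
Variables (p : \bar R) (s q r alpha : R).
Hypotheses (s0 : 0 < s) (sp : (s%:E < p)%E) (sq : s < q) (sr : s < r).
Hypothesis alpha1 : 1 <= alpha.
Variable f : M -> R.
Hypotheses (mf : measurable_fun setT f) (f0 : forall y, 0 <= f y).
Local Open Scope ereal_scope.
Hypothesis revH : forall (y : M) (t : R), (0 < t)%R ->
  ball y (2 * t) `<=` ball x (l * rho) ->
  Lavg mu p (ball y t) f <=
  A%:E * (Lavg mu r%:E (ball y (2 * t)) f + Lavg mu q%:E (ball y (2 * t)) f `^ alpha).

Let m := fine (mu (ball x (l * rho))).
Let wnorm e a := scaledLp mu m e (ball x (a * rho)) f.
Let Q a := ((32 * l / (l - a)) ^+ D)%R.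

Let lrho0 : (0 < l * rho)%R. Proof. exact: mulr_gt0 (lt_trans ltr01 l1) rho0. Qed.

Let mE : mu (ball x (l * rho)) = m%:E.
Proof. by rewrite fineK//; exact: (doubling_fin dblC). Qed.

Let m0 : (0 < m)%R.
Proof. by rewrite -lte_fin -mE; exact: (doubling_ball_gt0 dblC). Qed.

Let muT0 : 0 < mu setT.
Proof.
apply: (lt_le_trans (doubling_ball_gt0 dblC x lrho0)).
by apply: le_measure; rewrite ?inE//; exact: measurable_metric_ball.
Qed.

Let Q1 a : (1 <= a < l)%R -> (1 <= Q a)%R.
Proof.
move=> /andP[a1 al]; apply: exprn_ege1.
by rewrite ler_pdivlMr ?subr_gt0// mul1r; move: l1 => ?; lra.
Qed.

Let wnorm_ge0 e a : 0 <= wnorm e a. Proof. exact: scaledLp_ge0. Qed.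

Lemma mass_subball_le a y t : (1 <= a < l)%R -> ball x (a * rho) y ->
  ((l - a) / 8 * rho <= t)%R -> (m <= Q a * fine (mu (ball y t)))%R.
Proof.
move=> al xy tl.
have r0 : (0 < (l - a) / 8 * rho)%R.
  by case/andP: al => a1 al; rewrite mulr_gt0//; lra.
rewrite -lee_fin -mE EFinM fineK; last exact: (doubling_fin dblC _ (lt_le_trans r0 tl)).
apply: (le_trans (mass_ball_le dblC CD rho0 al xy)).
apply: lee_wpmul2l.
  by rewrite lee_fin (le_trans ler01)//; exact: Q1.
apply: le_measure; rewrite ?inE; [exact: measurable_metric_ball..|].
exact: le_ball.
Qed.

(** The reverse Hoelder inequality survives on the concentric balls
    [a B] and [a' B], [a' = (a + l) / 2], with a constant that blows up
    polynomially as [a] tends to [l]: cover [a B] by balls of radius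
    [(l - a) rho / 4], whose doubles just fit into [a' B]. *)
Lemma scaledLp_step a : (1 <= a < l)%R ->
  wnorm p a <= (A * Q a `^ ((1 + alpha) / s))%R%:E *
    (wnorm r%:E ((a + l) / 2)%R + wnorm q%:E ((a + l) / 2)%R `^ alpha).
Proof.
move=> al; have [[l1' rho0'] alpha1'] := (l1, rho0, alpha1).
have /andP[a1 al2] := al; set a' := ((a + l) / 2)%R.
have [c [xc cov cQ]] := ball_cover dblC x CD rho0 al.
set t := ((l - a) / 4 * rho)%R in cov.
have t0 : (0 < t)%R by rewrite /t mulr_gt0//; lra.
have t20 : (0 < 2 * t)%R by lra.
have QE : (Q a `^ ((1 + alpha) / s) = Q a `^ s^-1 * Q a `^ (alpha / s))%R.
  rewrite mulrDl mul1r powRD//; apply/implyP => _.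
  by rewrite gt_eqF// (lt_le_trans ltr01)//; exact: Q1.
have XX : 0 <= wnorm r%:E a' + wnorm q%:E a' `^ alpha.
  by rewrite adde_ge0// poweR_ge0.
rewrite QE mulrCA EFinM -muleA.
apply: (scaledLp_cover mf (l := c) (B := fun y => ball y t)
  (k := fun y => fine (mu (ball y t)))) => //.
- exact: ltW.
- exact: Q1.
- by rewrite mule_ge0// lee_fin mulr_ge0 ?powR_ge0// ltW.
- exact: measurable_metric_ball.
move=> y yc; have xy := xc y yc.
have yt : mu (ball y t) \is a fin_num by exact: (doubling_fin dblC).
have y2t : mu (ball y (2 * t)) \is a fin_num by exact: (doubling_fin dblC).
have sub2 : ball y (2 * t) `<=` ball x (a' * rho).
  by apply: (sub_ball_shift xy); rewrite /t /a'; lra.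
have subl e : (e <= l)%R -> ball x (e * rho) `<=` ball x (l * rho).
  by move=> el; apply: le_ball; rewrite ler_pM2r.
have a'l : (a' <= l)%R by rewrite /a'; lra.
split; first exact: measurable_metric_ball.
  rewrite fine_gt0/=; last by rewrite (doubling_ball_gt0 dblC)// ltey_eq yt.
  rewrite -lee_fin fineK// -mE.
  apply: le_measure; rewrite ?inE; [exact: measurable_metric_ball..|].
  apply: subset_trans (subl a' a'l); apply: subset_trans sub2.
  by apply: le_ball; lra.
rewrite -Lavg_scaledLp//; last exact: (doubling_ball_gt0 dblC).
apply: (le_trans (revH t0 (subset_trans sub2 (subl a' a'l)))).
rewrite EFinM -muleA lee_wpmul2l ?lee_fin ?(ltW A0)//.
have small e : (s < e)%R -> Lavg mu e%:E (ball y (2 * t)) f <=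
    (Q a `^ s^-1)%R%:E * wnorm e%:E a'.
  move=> se; have e0 := lt_trans s0 se.
  rewrite Lavg_scaledLp//; last exact: (doubling_ball_gt0 dblC).
  apply: (@le_trans _ _ ((Q a `^ s^-1)%R%:E * scaledLp mu m e%:E (ball y (2 * t)) f)).
    apply: (scaledLp_mass f0 muT0) => //; first by rewrite lee_fin ltW.
    - exact: Q1.
    - by rewrite fine_gt0// (doubling_ball_gt0 dblC)// ltey_eq y2t.
    - by apply: mass_subball_le => //; rewrite /t; nra.
  apply: lee_wpmul2l; first by rewrite lee_fin powR_ge0.
  by apply: scaledLp_sub => //; exact: measurable_metric_ball.
rewrite ge0_muleDr ?poweR_ge0//; apply: leeD.
  apply: (le_trans (small r sr)); apply: lee_wpmul2r => //.
  rewrite lee_fin ler_powR//; first exact: Q1.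
  by rewrite ler_pMl ?invr_gt0.
have -> : (Q a `^ (alpha / s))%R%:E = (Q a `^ s^-1)%R%:E `^ alpha.
  by rewrite poweR_EFin -powRrM mulrC.
rewrite -poweRM ?lee_fin ?powR_ge0//.
apply: lee_poweR; [lra| |exact: small].
by rewrite Lavg_scaledLp//; [exact: scaledLp_ge0|exact: (doubling_ball_gt0 dblC)].
Qed.

Variables (b1 b2 : R).
Hypotheses (b10 : (0 < b1)%R) (b11 : (b1 < 1)%R) (b20 : (0 < b2)%R) (b21 : (b2 < 1)%R).
Hypothesis r_eq : r%:E^-1 = b1%:E / p + (1 - b1)%:E / s%:E.
Hypothesis q_eq : q%:E^-1 = b2%:E / p + (1 - b2)%:E / s%:E.
Hypothesis b_eq : (b2 * alpha = b1)%R.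
Hypothesis pfin : wnorm p l < +oo.
Hypothesis sfin : wnorm s%:E l < +oo.

Let Phi a := fine (wnorm p a).
Let S := fine (wnorm s%:E l).
Let e := (D%:R * ((1 + alpha) / s))%R.
Let W := (S `^ (1 - b1) + S `^ ((1 - b2) * alpha))%R.

Let p0 : 0 < p. Proof. by apply: lt_trans sp; rewrite lte_fin. Qed.

Let wnorm_le ee a a' : 0 < ee -> (a <= a')%R -> wnorm ee a <= wnorm ee a'.
Proof.
move=> ee0 aa'; apply: scaledLp_sub => //; try exact: measurable_metric_ball.
by apply: le_ball; rewrite ler_pM2r.
Qed.

Let PhiE a : (a <= l)%R -> wnorm p a = (Phi a)%:E.
Proof.
move=> al; rewrite /Phi fineK// ge0_fin_numE//.
exact: le_lt_trans (wnorm_le p0 al) pfin.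
Qed.

Let SE : wnorm s%:E l = S%:E. Proof. by rewrite /S fineK// ge0_fin_numE. Qed.

Let Phi0 a : (0 <= Phi a)%R. Proof. exact: fine_ge0. Qed.
Let S0 : (0 <= S)%R. Proof. exact: fine_ge0. Qed.

Let interp b ee a : (0 < b < 1)%R -> (s < ee)%R -> (a <= l)%R ->
  ee%:E^-1 = b%:E / p + (1 - b)%:E / s%:E ->
  wnorm ee%:E a <= (Phi a `^ b * S `^ (1 - b))%R%:E.
Proof.
move=> b01 see al; have ee0 := lt_trans s0 see.
rewrite !inver !gt_eqF// => eeE.
apply: (le_trans (scaledLp_interpolation mf f0 muT0 _ m0 s0 ee0 p0 b01 eeE _)).
- exact: measurable_metric_ball.
- by rewrite -/(wnorm p a) PhiE// ltry.
rewrite -/(wnorm p a) PhiE// EFinM -poweR_EFin lee_wpmul2l// ?poweR_ge0//.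
rewrite -poweR_EFin -SE; apply: lee_poweR => //.
- by case/andP: b01 => *; lra.
- exact: scaledLp_ge0.
- by have := @wnorm_le s%:E a l; rewrite lte_fin => /(_ s0 al).
Qed.

(** Interpolating both terms of [scaledLp_step] between [L^p] and [L^s] gives the
    same power [b1 = b2 * alpha] of [Phi a'], which is less than [1]. *)
Lemma Phi_step a : (1 <= a < l)%R ->
  (Phi a <= (A * (32 * l) `^ e * W) * (l - a) `^ (- e) * Phi ((a + l) / 2) `^ b1)%R.
Proof.
move=> al; have [[l1' rho0'] alpha1'] := (l1, rho0, alpha1).
have /andP[a1 al2] := al; set a' := ((a + l) / 2)%R.
have a'l : (a' <= l)%R by rewrite /a'; lra.
rewrite -lee_fin -PhiE ?(ltW al2)//; apply: (le_trans (scaledLp_step al)).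
have QE : (Q a `^ ((1 + alpha) / s) = (32 * l) `^ e * (l - a) `^ (- e))%R.
  rewrite /Q -powR_mulrn; last by rewrite divr_ge0//; lra.
  rewrite -powRrM -/e powRM ?invr_ge0//; try lra.
  congr (_ * _)%R; rewrite -powR_inv1; last lra.
  by rewrite -powRrM mulN1r.
have -> : (A * (32 * l) `^ e * W * (l - a) `^ (- e) * Phi a' `^ b1)%R =
    (A * Q a `^ ((1 + alpha) / s) * (W * Phi a' `^ b1))%R by rewrite QE; ring.
rewrite [leRHS]EFinM lee_wpmul2l ?lee_fin ?mulr_ge0 ?powR_ge0 ?(ltW A0)//.
rewrite /W [X in _ <= X%:E]mulrDl EFinD; apply: leeD.
  by rewrite [X in _ <= X%:E]mulrC; apply: (@interp b1 r a') => //; rewrite b10.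
apply: (@le_trans _ _ ((Phi a' `^ b2 * S `^ (1 - b2))%R%:E `^ alpha)).
  apply: lee_poweR; [exact: le_trans ler01 alpha1|exact: wnorm_ge0|].
  by apply: (@interp b2 q a') => //; rewrite b20.
by rewrite poweR_EFin powRM ?powR_ge0// -!powRrM b_eq mulrC.
Qed.

Let theta := (alpha * (1 - b2) / (1 - b1))%R.

(** [absorption] bounds [Phi 1] by a multiple of [W ^ (1 / (1 - b1))], and this
    power turns the two terms of [W] into [S] and [S ^ theta]. *)
Lemma self_improvement : Lavg mu p (ball x rho) f <=
  (improvement_const D l A s alpha b1)%:E * (wnorm s%:E l + wnorm s%:E l `^ theta).
Proof.
have [[l1' rho0'] [alpha1' s0']] := ((l1, rho0), (alpha1, s0)).
have b1' : (0 < 1 - b1)%R by rewrite subr_gt0.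
have Bfin : mu (ball x rho) \is a fin_num by exact: (doubling_fin dblC).
have W0 : (0 <= W)%R by rewrite addr_ge0 ?powR_ge0.
have e0 : (0 <= e)%R by rewrite mulr_ge0// divr_ge0//; lra.
set K := (A * (32 * l) `^ e * 2 `^ (e / (1 - b1) * b1))%R.
have K0 : (0 <= K)%R by rewrite !mulr_ge0 ?powR_ge0// ltW.
have KW0 : (0 <= A * (32 * l) `^ e * W)%R.
  by rewrite !mulr_ge0 ?powR_ge0// ltW.
have Phi1 : (Phi 1 <= (l - 1) `^ (- (e / (1 - b1))) * (K * W) `^ (1 - b1)^-1)%R.
  have -> : (K * W = A * (32 * l) `^ e * W * 2 `^ (e / (1 - b1) * b1))%R.
    by rewrite /K; ring.
  apply: (absorption l1 e0 b11 (ltW b10) KW0 (M := Phi l)); last exact: Phi_step.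
  move=> a /andP[a1 al]; rewrite Phi0/= -lee_fin -!PhiE// ?(ltW al)//.
  exact: wnorm_le (ltW al).
have WS : (W `^ (1 - b1)^-1 <= 2 `^ (1 - b1)^-1 * (S + S `^ theta))%R.
  apply: le_trans (powRD_le _ _ _) _; rewrite ?powR_ge0// ?invr_ge0 ?(ltW b1')//.
  rewrite -!powRrM divff ?gt_eqF// powRr1// /theta.
  by rewrite [(alpha * _)%R]mulrC.
rewrite Lavg_scaledLp//; last exact: (doubling_ball_gt0 dblC).
apply: (@le_trans _ _ ((((2 * l) ^+ D) `^ s^-1)%R%:E * wnorm p 1)).
  rewrite /wnorm mul1r; apply: (scaledLp_mass f0 muT0) => //.
  - exact: ltW.
  - by apply: exprn_ege1; lra.
  - by rewrite fine_gt0// (doubling_ball_gt0 dblC)// ltey_eq Bfin.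
  - rewrite -lee_fin -mE EFinM fineK//.
    have := doubling_ratio dblC x CD rho0 (_ : (rho <= l * rho)%R).
    rewrite mulrA mulfK ?gt_eqF//; apply.
    by rewrite ler_pMl// ltW.
rewrite PhiE; last exact: ltW.
rewrite SE poweR_EFin -!EFinD -!EFinM lee_fin.
have -> : (improvement_const D l A s alpha b1 * (S + S `^ theta) =
    ((2 * l) ^+ D) `^ s^-1 * ((l - 1) `^ (- (e / (1 - b1))) *
    (K `^ (1 - b1)^-1 * (2 `^ (1 - b1)^-1 * (S + S `^ theta)))))%R.
  by rewrite /improvement_const -/e -/K; ring.
apply: ler_wpM2l; first exact: powR_ge0.
apply: (le_trans Phi1); apply: ler_wpM2l; first exact: powR_ge0.
by rewrite powRM// ler_wpM2l// powR_ge0.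
Qed.

End self_improvement.

Theorem theorem8p4 (R : realType) (p : \bar R) (s q r alpha beta1 beta2 : R)
  (s_gt0 : 0 < s) (s_lt_p : (s%:E < p)%E)
  (s_lt_q : s < q) (q_lt_p : (q%:E < p)%E)
  (s_lt_r : s < r) (r_lt_p : (r%:E < p)%E)
  (alpha_ge1 : 1 <= alpha)
  (beta1_gt0 : 0 < beta1) (beta1_lt1 : beta1 < 1)
  (beta2_gt0 : 0 < beta2) (beta2_lt1 : beta2 < 1)
  (r_eq : (r%:E^-1 = beta1%:E / p + (1 - beta1)%:E / s%:E)%E)
  (q_eq : (q%:E^-1 = beta2%:E / p + (1 - beta2)%:E / s%:E)%E)
  (beta_eq : beta2 * alpha = beta1)
  (lambda C A : R) (lambda_gt1 : 1 < lambda) (C_gt0 : 0 < C) (A_gt0 : 0 < A) :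
  let theta := alpha * (1 - beta2) / (1 - beta1) in
  1 <= theta /\
  exists K : R, 0 < K /\
    forall (d : measure_display) (M : metricMeasurableType R d)
      (mu : {measure set M -> \bar R}),
    doubling mu C ->
    forall (x : M) (rho : R), 0 < rho ->
    forall v : M -> R,
    nonneg_Lp_on mu p (ball x (lambda * rho)) v ->
    (forall (y : M) (t : R), 0 < t ->
       ball y (2 * t) `<=` ball x (lambda * rho) ->
       (Lavg mu p (ball y t) v <=
        A%:E * (avg mu (ball y (2 * t)) (fun z => v z `^ r)%R `^ (1 / r)
              + avg mu (ball y (2 * t)) (fun z => v z `^ q)%R
                  `^ (alpha / q)))%E) ->
    (Lavg mu p (ball x rho) v <=
     K%:E * (avg mu (ball x (lambda * rho)) (fun z => v z `^ s)%R `^ (1 / s)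
           + avg mu (ball x (lambda * rho)) (fun z => v z `^ s)%R
               `^ (theta / s)))%E.
Proof.
move=> theta.
have theta1 : 1 <= theta.
  by rewrite /theta ler_pdivlMr ?subr_gt0// -beta_eq; lra.
have theta0 := lt_le_trans ltr01 theta1.
split => //.
have [D CD] : exists D : nat, C <= 2 ^+ D.
  have [|n /andP[n1 _]] := @pow2_between _ (Num.max 1 C).
    by rewrite le_max lexx.
  by exists n; apply: le_trans n1; rewrite le_max lexx orbT.
have Kpos : 0 < improvement_const D lambda A s alpha beta1.
  by rewrite /improvement_const !mulr_gt0 ?powR_gt0 ?exprn_gt0 ?mulr_gt0 ?powR_gt0//; lra.
exists (improvement_const D lambda A s alpha beta1); split => //.
move=> d M mu dblC x rho rho0 v [mv v0 vfin] revH.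
set F := ball x (lambda * rho).
have lrho0 : 0 < lambda * rho by rewrite mulr_gt0//; lra.
have mF : measurable F by exact: measurable_metric_ball.
have Ffin : (mu F \is a fin_num)%E by exact: (doubling_fin dblC).
have F0 : (0 < mu F)%E by exact: (doubling_ball_gt0 dblC).
have m0 : 0 < fine (mu F) by rewrite fine_gt0// F0 ltey_eq Ffin.
have T0 : (0 < mu setT)%E.
  by apply: (lt_le_trans F0); apply: le_measure; rewrite ?inE.
have p0 : (0 < p)%E by apply: lt_trans s_lt_p; rewrite lte_fin.
(* Only the values of [v] on [F] matter; extending by 0 gives a function that is
   measurable and nonnegative everywhere. *)
pose f : M -> R := v \_ F.
have vf y : F y -> v y = f y by move=> Fy; rewrite /f patchT// inE.
have mf : measurable_fun setT f by exact/(measurable_restrictT _ mF).1.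
have f0 y : 0 <= f y.
  by rewrite /f patchE; case: ifPn => // /set_mem; exact: v0.
have avg_vf E (e c : R) : E `<=` F ->
    (avg mu E (fun z => v z `^ e)%R `^ (c / e) = (Lavg mu e%:E E f) `^ c)%E.
  by move=> EF; rewrite avg_poweR (@eq_Lavg _ _ _ _ _ _ v f)// => y /EF /vf.
have Lavg0 e E : (0 <= Lavg mu e%:E E f)%E by exact: poweR_ge0.
rewrite !avg_vf// poweRe1//.
rewrite (@eq_Lavg _ _ _ _ _ _ v f); last first.
  by move=> y yB; apply: vf; apply: le_ball yB; rewrite ler_pMl// ltW.
rewrite (Lavg_scaledLp _ _ Ffin F0).
(* If the [L^s] norm is infinite there is nothing to prove. *)
have [sfin|] := ltP (scaledLp mu (fine (mu F)) s%:E F f) +oo%E; last first.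
  rewrite leye_eq => /eqP ->; rewrite poweRyr ?gt_eqF//.
  by rewrite addye// gt0_muley ?leey// lte_fin.
apply: (self_improvement dblC CD rho0 lambda_gt1 A_gt0 s_gt0 s_lt_p s_lt_q s_lt_r
  alpha_ge1 mf f0 _ beta1_gt0 beta1_lt1 beta2_gt0 beta2_lt1 r_eq q_eq beta_eq _ sfin).
- move=> y t t0 tF.
  have := revH y t t0 tF; rewrite !avg_vf// poweRe1// (@eq_Lavg _ _ _ _ _ _ v f)//.
  move=> z yz; apply: vf; apply: tF; apply: le_ball yz; lra.
- apply: finite_norm_scaledLp => //; rewrite -/F (_ : f \_ F = v \_ F)//.
  by apply/funext => y; rewrite /f !patchE; case: ifP => // ->.
Qed.
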